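(* Let $A,F,C,D,I,P,Q\in\mathbb R$, $M\ge0$, $K>0$, $\rho>0$, $0<\underline\sigma\le\overline\sigma<\infty$, and let $\alpha_0,\alpha_1\in\mathbb R$, $\alpha_2<0$ (not depending on $\lambda$) be such that the following statement (a) for every $\lambda>0$ (or equivalently, (b)) holds. (a) The value function of the exploratory LQ problem with exploration weight $\lambda$ is $V(x)=\tfrac12\alpha_2x^2+\alpha_1x+\alpha_0+\frac{\lambda}{2\rho}\big(\ln\big(\frac{2\pi e\lambda}{K-\alpha_2D^2\overline\sigma^2}\big)-1\big)$, $x\in\mathbb R$, and the corresponding optimal randomized feedback control is $\boldsymbol\theta^*(u;x)=\mathcal N(u|\mu_3,\sigma_3^2)$ with $\mu_3=\frac{(\alpha_2(F+CD\overline\sigma^2)-I)x+\alpha_1F-Q}{K-\alpha_2D^2\overline\sigma^2}$ and $\sigma_3^2=\frac{\lambda}{K-\alpha_2D^2\overline\sigma^2}$. (b) The value function of the non-exploratory LQ problem is $V^{ne}(x)=\tfrac12\alpha_2x^2+\alpha_1x+\alpha_0$, $x\in\mathbb R$, and the corresponding optimal feedback control is $\boldsymbol u^*(x)=\frac{(\alpha_2(F+CD\overline\sigma^2)-I)x+\alpha_1F-Q}{K-\alpha_2D^2\overline\sigma^2}$. Then for each $x\in\mathbb R$, $$\lim_{\lambda\to0}\boldsymbol\theta^*(\cdot;x)=\delta_{\boldsymbol u^*(x)}(\cdot)\quad\text{weakly},$$ where $\delta_a$ is the Dirac measure at $a$. In addition, for each $x\in\mathbb R$, $$\lim_{\lam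bda\to0}|V(x)-V^{ne}(x)|=0.$$
   Context: Setting. Work on Peng's $G$-expectation space $(\Omega,\mathcal H,\{\mathcal F_t\}_{t\ge0},\hat{\mathbb E})$ ($\hat{\mathbb E}$ a sublinear expectation, $\hat{\mathbb E}[X]=\sup_{\mathbb P\in\mathcal P}E_{\mathbb P}[X]$ for a family $\mathcal P$ of probability measures), with $B$ a scalar $G$-Brownian motion, $B(1)\sim\mathcal N(0,[\underline\sigma^2,\overline\sigma^2])$. The lower expectation is $\mathcal E[X]=-\hat{\mathbb E}[-X]$. ''q.s.'' (quasi-surely) means outside a set of zero capacity $\sup_{\mathbb P\in\mathcal P}\mathbb P(\cdot)$. The reward is $r(x,u)=-(\frac M2x^2+Ixu+\frac K2u^2+Px+Qu)$, $x,u\in\mathbb R$; actions are unconstrained ($U=\mathbb R$). $\mathcal N(u|\mu,s^2)$ is the Gaussian density; a density is identified with the probability measure it defines. Exploratory LQ problem with weight $\lambda>0$. For a process $\theta=\{\theta_t\}$ with values in the set $\mathcal P(\mathbb R)$ of probability densities on $\mathbb R$, put $\mu_t=\int u\theta_t(u)du$, $\sigma_t^2=\int u^2\theta_t(u)du-\mu_t^2$, and let $dX_t^\theta=(AX_t^\theta+F\mu_t)dt+\sqrt{(CX_t^\theta+D\mu_t)^2+D^2\sigma_t^2}\,dB_t$, $X_0^\theta=x$, and $g(X_t^\theta,\theta_t)=\int_{\mathbb R}r(X_t^\theta,u)\theta_t(u)du-\lambda\int_{\mathbb R}\theta_t(u)\ln\theta_t(u)du$. $\mathcal A(x)$ is the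 set of $\theta$ with: (i) $\theta_t\in\mathcal P(\mathbb R)$ q.s. for each $t$; (ii) for each Borel $S$, $\{\int_S\theta_t(u)du\}$ is $\mathcal F_t$-progressively measurable; (iii) $\hat{\mathbb E}[\int_0^t(\mu_s^2+\sigma_s^2)ds]<\infty$ for each $t$; (iv) $\liminf_{T\to\infty}e^{-\rho T}\hat{\mathbb E}[(X_T^\theta)^2]=0$; (v) $\hat{\mathbb E}[\int_0^\infty e^{-\rho t}|g(X_t^\theta,\theta_t)|dt]<\infty$. The value function is $V(x)=\sup_{\theta\in\mathcal A(x)}\mathcal E[\int_0^\infty e^{-\rho t}g(X_t^\theta,\theta_t)dt\,|\,X_0^\theta=x]$ (it depends on $\lambda$). Non-exploratory LQ problem. $dx_t^u=(Ax_t^u+Fu_t)dt+(Cx_t^u+Du_t)dB_t$, $x_0^u=x$, with value function $V^{ne}(x)=\sup_{u\in\mathcal A^{ne}(x)}\mathcal E[\int_0^\infty e^{-\rho t}r(x_t^u,u_t)dt\,|\,x_0^u=x]$, where $\mathcal A^{ne}(x)$ is the set of $\{\mathcal F_t\}$-progressively measurable real-valued $u$ with $\hat{\mathbb E}[\int_0^tu_s^2ds]<\infty$ for each $t$, $\liminf_{T\to\infty}e^{-\rho T}\hat{\mathbb E}[(x_T^u)^2]=0$, and $\hat{\mathbb E}[\int_0^\infty e^{-\rho t}|r(x_t^u,u_t)|dt]<\infty$. A feedback control ($\boldsymbol\theta(\cdot;x)$, respectively $\boldsymbol u(x)$) is optimal if, for every initial state $x$, the closed-loop state equation (with $\theta_t=\boldsymbol\theta(\cdot;X_t)$,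 respectively $u_t=\boldsymbol u(x_t)$) has a unique strong solution and the open-loop control so generated is admissible and attains the supremum. The equivalence of (a) and (b) (for the same constants) is a separate result of the paper and may be taken as part of the hypothesis, i.e. (b) holds and (a) holds for every $\lambda>0$. *)

(* Defs.v *)
From HB Require Import structures.
From mathcomp Require Import all_boot all_order all_algebra.
From mathcomp Require Import all_classical all_reals all_analysis.

Set Implicit Arguments.
Unset Strict Implicit.
Unset Printing Implicit Defensive.

Import Order.TTheory GRing.Theory Num.Theory.
Import numFieldNormedType.Exports.

Local Open Scope classical_set_scope.
Local Open Scope ring_scope.

(** * The path space C_0([0, +oo); R) *)

(* A continuous path on [0, +oo) started at 0 is represented by its unique
   extension to R that vanishes on (-oo, 0]. *)
Record path0 (R : realType) := Path0 {
  path_fun :> R -> R ;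
  path_cont : continuous path_fun ;
  path_neg : forall t, t <= 0 -> path_fun t = 0 }.

HB.instance Definition _ (R : realType) := gen_eqMixin (path0 R).
HB.instance Definition _ (R : realType) := gen_choiceMixin (path0 R).

Definition zero_path (R : realType) : path0 R :=
  @Path0 R (fun=> 0) (fun=> @cvg_cst _ _ _ _ _) (fun _ _ => erefl).

HB.instance Definition _ (R : realType) :=
  isPointed.Build (path0 R) (zero_path R).

(* The sigma-algebra generated by the coordinates is the Borel sigma-algebra
   of locally uniform convergence. *)
Definition coordinate_sets (R : realType) : set (set (path0 R)) :=
  [set (fun w : path0 R => w s) @^-1` S |
    s in [set: R] & S in [set S : set R | measurable S]].

Notation Omega R := (g_sigma_algebraType (@coordinate_sets R)).

Definition BM (R : realType) (t : R) (w : Omega R) : R := path_fun w t.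

Definition Filt (R : realType) (t : R) : set (set (Omega R)) :=
  <<s [set @BM R s @^-1` S |
        s in [set s : R | 0 <= s <= t] & S in [set S : set R | measurable S]] >>.

(* Joint measurability of X on [0, t] x Omega for B([0, t]) (x) F_t, t >= 0. *)
Definition progressive (R : realType) (X : R -> Omega R -> R) : Prop :=
  forall (t : R), 0 <= t -> forall S : set R, measurable S ->
    <<s [set A `*` B |
          A in [set A : set R | measurable A] & B in Filt t] >>
      [set p : R * Omega R | 0 <= p.1 <= t /\ S (X p.1 p.2)].

(** * Sublinear expectation *)

Section SublinearExpectation.
Context {R : realType}.
Implicit Types (PP : set (probability (Omega R) R)).
Local Open Scope ereal_scope.

Definition Ghat PP (X : Omega R -> \bar R) : \bar R :=
  ereal_sup [set \int[P]_w X w | P in PP].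

Definition Glow PP (X : Omega R -> \bar R) : \bar R :=
  - Ghat PP (fun w => - X w).

Definition capacity PP (A : set (Omega R)) : \bar R :=
  ereal_sup [set (P : probability _ _) A | P in PP].

Definition quasi_surely PP (Q : Omega R -> Prop) : Prop :=
  exists N : set (Omega R),
    [/\ measurable N, capacity PP N = 0 & forall w, ~ N w -> Q w].

End SublinearExpectation.

(** * G-Brownian motion *)

Section GBrownian.
Context {R : realType}.
Implicit Types (PP : set (probability (Omega R) R)) (X Y : Omega R -> R).

(* The test functions C_{l,Lip}(V): locally Lipschitz with a Lipschitz constant
   of polynomial growth. *)
Definition clLip (V : normedModType R) (phi : V -> R) : Prop :=
  exists (C : R) (m : nat), forall x y : V,
    `|phi x - phi y| <= C * (1 + `|x| ^+ m + `|y| ^+ m) * `|x - y|.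

(* Y is independent from the random vector X. *)
Definition Gindep PP (n : nat) (X : Omega R -> 'rV[R]_n) Y : Prop :=
  forall phi : ('rV[R]_n * R)%type -> R, clLip phi ->
    Ghat PP (fun w => (phi (X w, Y w))%:E) =
    Ghat PP (fun w => Ghat PP (fun w' => (phi (X w, Y w'))%:E)).

(* X ~ N(0, [slo2, shi2]): for an independent copy X' of X, a X + b X' is
   distributed as sqrt (a^2 + b^2) X.  The copy lives on the product space, where
   E[phi (a X + b X')] is by construction the iterated expectation below. *)
Definition Gnormal PP X (slo2 shi2 : R) : Prop :=
  [/\ forall a b : R, 0 <= a -> 0 <= b ->
        forall phi : R -> R, clLip (phi : R^o -> R) ->
        Ghat PP (fun w => Ghat PP (fun w' => (phi (a * X w + b * X w'))%:E)) =
        Ghat PP (fun w => (phi (Num.sqrt (a ^+ 2 + b ^+ 2) * X w))%:E),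
      Ghat PP (fun w => (X w ^+ 2)%:E) = shi2%:E &
      Glow PP (fun w => (X w ^+ 2)%:E) = slo2%:E].

(* The canonical process is a G-Brownian motion with B(1) ~ N(0,[slo^2,shi^2])
   for the sublinear expectation sup_(P in PP) E_P.  The moment condition says
   that this expectation is real-valued on the cylinder functions. *)
Definition G_expectation PP (slo shi : R) : Prop :=
  [/\ forall (t : R) (m : nat), 0 <= t ->
        (Ghat PP (fun w => (`|BM t w| ^+ m)%:E) < +oo)%E,
      forall t s : R, 0 <= t -> 0 <= s ->
        Gnormal PP (fun w => BM (t + s) w - BM t w)
          (s * slo ^+ 2) (s * shi ^+ 2) &
      forall t s : R, 0 <= t -> 0 <= s ->
        forall (n : nat) (ts : 'I_n -> R), (forall i, 0 <= ts i <= t) ->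
        Gindep PP (fun w => \row_(i < n) BM (ts i) w)
          (fun w => BM (t + s) w - BM t w)].

End GBrownian.

(** * Stochastic integral and stochastic differential equations *)

Section Ito.
Context {R : realType}.
Implicit Types (PP : set (probability (Omega R) R)).
Local Notation leb := (@lebesgue_measure R).

Record step_process := StepProcess {
  sp_size : nat ;
  sp_time : nat -> R ;
  sp_coef : nat -> Omega R -> R }.

Definition step_process_on (T : R) (p : step_process) : Prop :=
  [/\ sp_time p 0%N = 0, sp_time p (sp_size p) = T &
      forall i, (i < sp_size p)%N ->
        [/\ sp_time p i <= sp_time p i.+1,
            exists C : R, forall w, `|sp_coef p i w| <= C &
            forall S : set R, measurable S ->
              Filt (sp_time p i) (sp_coef p i @^-1` S)]].

Definition step_value (p : step_process) (s : R) (w : Omega R) : R :=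
  \sum_(i < sp_size p)
    sp_coef p i w * \1_(`[sp_time p i, sp_time p i.+1[) s.

Definition step_integral (p : step_process) (w : Omega R) : R :=
  \sum_(i < sp_size p)
    sp_coef p i w * (BM (sp_time p i.+1) w - BM (sp_time p i) w).

(* Y is (a version of) the integral of eta against B over [0, T]: eta is the limit
   of step processes for the norm E[int_0^T |.|^2 ds]^(1/2) and Y is the limit of
   their integrals for the norm E[|.|^2]^(1/2). *)
Definition is_ito_integral PP (T : R) (eta : R -> Omega R -> R)
    (Y : Omega R -> R) : Prop :=
  exists p : nat -> step_process,
    [/\ forall k, step_process_on T (p k),
        Ghat PP (fun w => \int[leb]_(s in `[0%R, T])
          ((eta s w - step_value (p k) s w) ^+ 2)%:E)%E @[k --> \oo] --> 0%E &
        Ghat PP (fun w => ((Y w - step_integral (p k) w) ^+ 2)%:E)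
          @[k --> \oo] --> 0%E].

(* X_t = x + int_0^t b_s ds + int_0^t v_s dB_s, where b and v may depend on X. *)
Definition sde_solution PP (b v : R -> Omega R -> R) (x : R)
    (X : R -> Omega R -> R) : Prop :=
  [/\ progressive X,
      progressive b /\ progressive v,
      quasi_surely PP (fun w =>
        {within `[0, +oo[, continuous (X^~ w)} /\ X 0 w = x),
      forall t : R, 0 <= t -> quasi_surely PP (fun w =>
        leb.-integrable `[0%R, t] (fun s => (b s w)%:E)) &
      forall t : R, 0 <= t -> is_ito_integral PP t v
        (fun w => X t w - x - \int[leb]_(s in `[0%R, t]) b s w)].

Definition qs_indistinguishable PP (X Y : R -> Omega R -> R) : Prop :=
  quasi_surely PP (fun w => forall t : R, 0 <= t -> X t w = Y t w).

End Ito.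

(** * The linear-quadratic problems *)

Record lq_data (R : realType) := LQData {
  lqA : R ; lqF : R ; lqC : R ; lqD : R ;
  lqM : R ; lqI : R ; lqK : R ; lqP : R ; lqQ : R ;
  lq_rho : R }.

Section LQ.
Context {R : realType}.
Implicit Types (PP : set (probability (Omega R) R)) (c : lq_data R).
Local Notation leb := (@lebesgue_measure R).

Definition reward c (x u : R) : R :=
  - (lqM c / 2 * x ^+ 2 + lqI c * x * u + lqK c / 2 * u ^+ 2
     + lqP c * x + lqQ c * u).

Definition terminal_condition PP c (X : R -> Omega R -> R) : Prop :=
  limf_einf (fun T : R => ((expR (- (lq_rho c) * T))%:E
      * Ghat PP (fun w => (X T w ^+ 2)%:E))%E) (pinfty_nbhs R) = 0%E.

(** ** Non-exploratory problem *)

Definition state_ne PP c (x : R) (u X : R -> Omega R -> R) : Prop :=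
  sde_solution PP
    (fun t w => lqA c * X t w + lqF c * u t w)
    (fun t w => lqC c * X t w + lqD c * u t w) x X.

Definition payoff_ne c (u X : R -> Omega R -> R) (w : Omega R) : \bar R :=
  (\int[leb]_(t in `[0%R, +oo[)
     (expR (- (lq_rho c) * t) * reward c (X t w) (u t w))%:E)%E.

Definition admissible_ne PP c (x : R) (u X : R -> Omega R -> R) : Prop :=
  [/\ progressive u,
      state_ne PP c x u X,
      forall t : R, 0 <= t ->
        (Ghat PP (fun w => \int[leb]_(s in `[0%R, t]) (u s w ^+ 2)%:E) < +oo)%E,
      terminal_condition PP c X &
      (Ghat PP (fun w => \int[leb]_(t in `[0%R, +oo[)
         (expR (- (lq_rho c) * t) * `|reward c (X t w) (u t w)|)%:E)
       < +oo)%E].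

Definition value_ne PP c (x : R) : \bar R :=
  ereal_sup [set J | exists u X, admissible_ne PP c x u X /\
                                 J = Glow PP (payoff_ne c u X)].

Definition optimal_feedback_ne PP c (ufb : R -> R) : Prop :=
  forall x : R, exists X : R -> Omega R -> R,
    let u (Z : R -> Omega R -> R) := fun t w => ufb (Z t w) in
    [/\ state_ne PP c x (u X) X,
        forall X', state_ne PP c x (u X') X' -> qs_indistinguishable PP X' X,
        admissible_ne PP c x (u X) X &
        Glow PP (payoff_ne c (u X) X) = value_ne PP c x].

(** ** Exploratory problem *)

Definition is_density (f : R -> R) : Prop :=
  [/\ measurable_fun setT f, forall u, 0 <= f u &
      (\int[leb]_u (f u)%:E = 1)%E].

Definition dmean (f : R -> R) : R := \int[leb]_u (u * f u).

(* Extended-real, so that an infinite second moment gives +oo. *)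
Definition dvar (f : R -> R) : \bar R :=
  (\int[leb]_u (u ^+ 2 * f u)%:E - (dmean f ^+ 2)%:E)%E.

(* [ln 0 = 0] in the library, hence 0 ln 0 = 0. *)
Definition explor_reward c (lam x : R) (f : R -> R) : \bar R :=
  (\int[leb]_u (reward c x u * f u)%:E
   - lam%:E * \int[leb]_u (f u * ln (f u))%:E)%E.

Implicit Types theta : R -> Omega R -> R -> R.

Definition state PP c (x : R) theta (X : R -> Omega R -> R) : Prop :=
  sde_solution PP
    (fun t w => lqA c * X t w + lqF c * dmean (theta t w))
    (fun t w => Num.sqrt ((lqC c * X t w + lqD c * dmean (theta t w)) ^+ 2
                          + lqD c ^+ 2 * fine (dvar (theta t w)))) x X.

Definition payoff c (lam : R) theta (X : R -> Omega R -> R)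
    (w : Omega R) : \bar R :=
  (\int[leb]_(t in `[0%R, +oo[)
     ((expR (- (lq_rho c) * t))%:E
      * explor_reward c lam (X t w) (theta t w)))%E.

Definition admissible PP c (lam x : R) theta (X : R -> Omega R -> R) : Prop :=
  state PP c x theta X /\
  [/\ forall t : R, 0 <= t -> quasi_surely PP (fun w => is_density (theta t w)),
      forall S : set R, measurable S ->
        progressive (fun t w => \int[leb]_(u in S) theta t w u),
      forall t : R, 0 <= t ->
        (Ghat PP (fun w => \int[leb]_(s in `[0%R, t])
           ((dmean (theta s w) ^+ 2)%:E + dvar (theta s w))) < +oo)%E,
      terminal_condition PP c X &
      (Ghat PP (fun w => \int[leb]_(t in `[0%R, +oo[)
         ((expR (- (lq_rho c) * t))%:E
          * `|explor_reward c lam (X t w) (theta t w)|)) < +oo)%E].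

Definition value PP c (lam x : R) : \bar R :=
  ereal_sup [set J | exists theta X, admissible PP c lam x theta X /\
                                     J = Glow PP (payoff c lam theta X)].

(* [pol x] is the density of the randomized action taken in state x. *)
Definition optimal_feedback PP c (lam : R) (pol : R -> R -> R) : Prop :=
  forall x : R, exists X : R -> Omega R -> R,
    let theta (Z : R -> Omega R -> R) := fun t w => pol (Z t w) in
    [/\ state PP c x (theta X) X,
        forall X', state PP c x (theta X') X' -> qs_indistinguishable PP X' X,
        admissible PP c lam x (theta X) X &
        Glow PP (payoff c lam (theta X) X) = value PP c lam x].

(** ** The explicit solutions *)

Definition curvature c (shi alpha2 : R) : R :=
  lqK c - alpha2 * lqD c ^+ 2 * shi ^+ 2.

Definition ustar c (shi alpha1 alpha2 : R) (x : R) : R :=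
  ((alpha2 * (lqF c + lqC c * lqD c * shi ^+ 2) - lqI c) * x
   + alpha1 * lqF c - lqQ c) / curvature c shi alpha2.

(* [normal_pdf] takes the standard deviation as its second argument. *)
Definition thetastar c (shi alpha1 alpha2 lam : R) (x : R) : R -> R :=
  normal_pdf (ustar c shi alpha1 alpha2 x)
    (Num.sqrt (lam / curvature c shi alpha2)).

Definition exploratory_solution PP c (shi alpha0 alpha1 alpha2 lam : R) : Prop :=
  (forall x : R, value PP c lam x =
     (alpha2 / 2 * x ^+ 2 + alpha1 * x + alpha0
      + lam / (2 * lq_rho c)
        * (ln (2 * pi * expR 1 * lam / curvature c shi alpha2) - 1))%:E) /\
  optimal_feedback PP c lam (thetastar c shi alpha1 alpha2 lam).

Definition nonexploratory_solution PP c (shi alpha0 alpha1 alpha2 : R) : Prop :=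
  (forall x : R, value_ne PP c x =
     (alpha2 / 2 * x ^+ 2 + alpha1 * x + alpha0)%:E) /\
  optimal_feedback_ne PP c (ustar c shi alpha1 alpha2).

End LQ.

(** * Weak convergence of measures on the line *)

Definition density_measure (R : realType) (f : R -> R)
    (S : set (measurableTypeR R)) : \bar R :=
  (\int[@lebesgue_measure R]_(u in S) (f u)%:E)%E.

Definition weak_cvg (R : realType) (T : Type) (F : set_system T)
    (m : T -> set (measurableTypeR R) -> \bar R)
    (m0 : set (measurableTypeR R) -> \bar R) : Prop :=
  forall f : R -> R, continuous f -> (exists C : R, forall u, `|f u| <= C) ->
    (\int[m l]_u (f u)%:E)%E @[l --> F] --> (\int[m0]_u (f u)%:E)%E.

(* Main.v *)
(** By (a) and (b) the two value functions differ by an affine combination of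
    [lam] and [lam * ln lam], both of which vanish at 0+.  The optimal policies
    are normal laws with a fixed mean and a variance proportional to [lam], so
    their mass outside any neighbourhood of the mean vanishes; against a bounded
    continuous test function only the value at the mean remains. *)

Require Import Defs.
From HB Require Import structures.
From mathcomp Require Import all_boot all_order all_algebra.
From mathcomp Require Import all_classical all_reals all_analysis.
From mathcomp Require Import measurable_realfun ring.
Import Order.TTheory GRing.Theory Num.Theory.
Import numFieldNormedType.Exports.
Local Open Scope classical_set_scope.
Local Open Scope ring_scope.

Lemma bounded_integrable d (T : measurableType d) (R : realType)
    (P : probability T R) (f : T -> R) (C : R) :
  measurable_fun setT f -> (forall u, `|f u| <= C) ->
  P.-integrable setT (EFin \o f).
Proof.
move=> mf fC; apply: measurable_bounded_integrable => //.
  by rewrite [X in (X < _)%E]probability_setT ltry.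
exists C; split; first exact: num_real.
by move=> x Cx u _ /=; rewrite (le_trans (fC u))// ltW.
Qed.

(** Off [A] the integrand [f - a] is at most [e] in absolute value; on [A] only the crude bound
    [2 * C] is available. So [e + 2 * C * \1_A] dominates it everywhere, and [P] has total mass
    1. *)
Lemma normr_RintegralB_le d (T : measurableType d) (R : realType)
    (P : probability T R) (f : T -> R) (A : set T) (a e C : R) :
  measurable_fun setT f -> (forall u, `|f u| <= C) -> `|a| <= C -> 0 <= e ->
  measurable A -> (forall u, ~ A u -> `|f u - a| <= e) ->
  `|\int[P]_u f u - a| <= e + 2 * C * fine (P A).
Proof.
move=> mf fC aC e0 mA fA.
have intC (k : R) : P.-integrable setT (EFin \o cst k).
  exact: finite_measure_integrable_cst.
have int_cst (k : R) : \int[P]_(_ in setT) k = k.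
  by rewrite Rintegral_cst// [X in fine X]probability_setT mulr1.
have intf := bounded_integrable _ _ _ P _ _ mf fC.
have C0 : 0 <= C := le_trans (normr_ge0 a) aC.
have mI : measurable_fun setT (fun u : T => 2 * C * (\1_A u : R)).
  by apply: measurable_funM => //; exact: measurable_indic.
have intI : P.-integrable setT (EFin \o (fun u : T => 2 * C * (\1_A u : R))).
  apply: (bounded_integrable _ _ _ _ _ (2 * C)) => // u.
  by rewrite ger0_norm ?mulr_ge0 ?ler_piMr ?mulr_ge0.
have mB : measurable_fun setT (fun u => f u - a) by apply: measurable_funB.
have BC u : `|f u - a| <= 2 * C.
  by rewrite (le_trans (ler_normB _ _))// mulr_natl mulr2n lerD.
have intB := bounded_integrable _ _ _ P _ _ mB BC.
(* Since [P] is a probability, [a] is the integral of the constant [a]. *)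
have -> : \int[P]_u f u - a = \int[P]_u (f u - a).
  by rewrite RintegralB// ?int_cst//; exact: (intC a).
apply: le_trans (le_normr_Rintegral _ intB) _ => //.
have -> : e + 2 * C * fine (P A) = \int[P]_u (e + 2 * C * \1_A u).
  rewrite RintegralD//; last exact: (intC e).
  rewrite int_cst RintegralZl//; last first.
    apply: (bounded_integrable _ _ _ _ _ 1); first exact: measurable_indic.
    by move=> u; rewrite indicE; case: (_ \in _); rewrite ?normr1 ?normr0.
  by rewrite /Rintegral integral_indic// setIT.
apply: le_Rintegral => //.
- apply: (bounded_integrable _ _ _ _ _ (2 * C)) => [|u].
    exact: measurableT_comp.
  by rewrite normr_id.
- exact: (integrableD measurableT (intC e) intI).
move=> u _; rewrite indicE; have [uA|uA] := boolP (u \in A).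
  by rewrite mulr1 (le_trans (BC u))// lerDr.
by rewrite mulr0 addr0 fA// => /mem_set; exact/negP.
Qed.

(* Half of the exponent gives the small factor, by [exp (- y) <= 1 / y]; the other
   half is, up to normalization, the density with twice the variance. *)
Lemma normal_pdf_tail (R : realType) (m s t u : R) : 0 < s -> 0 < t ->
  t <= `|u - m| ->
  normal_pdf m s u <=
  Num.sqrt 2 * (4 * s ^+ 2 / t ^+ 2) * normal_pdf m (Num.sqrt 2 * s) u.
Proof.
move=> s0 t0 tu.
have r0 : 0 < Num.sqrt 2 :> R by rewrite sqrtr_gt0.
have r2 : Num.sqrt 2 ^+ 2 = 2 :> R by rewrite sqr_sqrtr.
have rs0 : 0 < Num.sqrt 2 * s by rewrite mulr_gt0.
rewrite !normal_pdfE ?gt_eqF//.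
have pE : normal_peak s = Num.sqrt 2 * normal_peak (Num.sqrt 2 * s).
  rewrite /normal_peak exprMn r2.
  rewrite (_ : 2 * s ^+ 2 * pi *+ 2 = 2 * (s ^+ 2 * pi *+ 2)); last by ring.
  by rewrite [in RHS]sqrtrM// invfM mulrA divff ?gt_eqF// mul1r.
pose y := (u - m) ^+ 2 / (4 * s ^+ 2).
have fE : normal_fun m s u = expR (- y) * normal_fun m (Num.sqrt 2 * s) u.
  rewrite /normal_fun -expRD /y exprMn r2; congr expR.
  by field; rewrite gt_eqF.
have yt : t ^+ 2 / (4 * s ^+ 2) <= y.
  rewrite ler_pM2r ?invr_gt0 ?mulr_gt0 ?exprn_gt0//.
  rewrite -(real_normK (num_real (u - m))) lerXn2r// nnegrE ?ltW//.
(* After inversion this is [t ^+ 2 / (4 * s ^+ 2) <= expR y], which follows from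
   [y <= 1 + y <= expR y]. *)
have ye : expR (- y) <= 4 * s ^+ 2 / t ^+ 2.
  have t'0 : 0 < t ^+ 2 / (4 * s ^+ 2) by rewrite divr_gt0 ?mulr_gt0 ?exprn_gt0.
  rewrite expRN -[leRHS]invrK invf_div lef_pV2 ?posrE ?expR_gt0//.
  by rewrite (le_trans yt)// (le_trans _ (expR_ge1Dx _))// lerDr.
rewrite pE fE.
set p := normal_peak _; set q := normal_fun _ _ _.
rewrite (_ : _ * (_ * q) = expR (- y) * (Num.sqrt 2 * p * q)); last by ring.
rewrite (_ : _ * _ * (p * q) = 4 * s ^+ 2 / t ^+ 2 * (Num.sqrt 2 * p * q)); last by ring.
by rewrite ler_wpM2r// !mulr_ge0 ?normal_peak_ge0 ?normal_fun_ge0 ?ltW.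
Qed.

Lemma measurable_tail (R : realType) (m t : R) :
  measurable [set u | t <= `|u - m|].
Proof.
rewrite (_ : [set _ | _] = (fun u : R => `|u - m|) @^-1` `[t, +oo[); last first.
  by apply/seteqP; split => u /=; rewrite in_itv/= andbT.
rewrite -[X in measurable X]setTI.
apply: (_ : measurable_fun setT (fun u : R => `|u - m|)) => //.
by apply: measurableT_comp => //; exact: measurable_funB.
Qed.

(** A Chebyshev-type bound obtained without computing a variance: on the tail the density is at most
    a multiple of the wider normal density, and the latter has mass at most 1 there. For fixed [t]
    the bound is of order [s ^+ 2]. *)
Lemma normal_prob_tail (R : realType) (m s t : R) : 0 < s -> 0 < t ->
  (normal_prob m s [set u | t <= `|u - m|]%R <=
   (Num.sqrt 2 * (4 * s ^+ 2 / t ^+ 2))%:E)%E.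
Proof.
move=> s0 t0; set k := Num.sqrt 2 * _; set A := [set u | _].
have k0 : 0 <= k by rewrite !mulr_ge0 ?invr_ge0 ?exprn_ge0 ?ltW// sqr_ge0.
have mA : measurable A by exact: measurable_tail.
have mpdf (s' : R) : measurable_fun setT (fun u => (normal_pdf m s' u)%:E).
  by apply/measurable_EFinP; exact: measurable_normal_pdf.
set s' := Num.sqrt 2 * s.
have mk : measurable_fun setT (fun u => (k%:E * (normal_pdf m s' u)%:E)%E).
  exact: measurable_funeM.
have p0 (s'' u : R) : (0 <= (normal_pdf m s'' u)%:E)%E.
  by rewrite lee_fin normal_pdf_ge0.
rewrite /normal_prob.
apply: (@le_trans _ _
  (\int[lebesgue_measure]_(u in A) (k%:E * (normal_pdf m s' u)%:E))%E).
  apply: ge0_le_integral => //.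
  - exact: (measurable_funTS (mpdf s)).
  - exact: (measurable_funTS mk).
  - by move=> u Au; rewrite -EFinM lee_fin; exact: normal_pdf_tail.
apply: (@le_trans _ _
  (\int[lebesgue_measure]_u (k%:E * (normal_pdf m s' u)%:E))%E).
  by apply: ge0_subset_integral => // u _; rewrite mule_ge0// lee_fin.
by rewrite ge0_integralZl_EFin ?integral_normal_pdf ?mule1//; last exact: (mpdf s').
Qed.

(** Continuity of [f] at [m] controls the integral near [m], the tail bound controls the rest. The
    deviations [s l] need only be positive eventually, so that one-sided limits are covered. *)
Lemma normal_prob_weak_cvg (R : realType) (T : Type) (F : set_system T)
    (FF : Filter F) (m : R) (s : T -> R) (f : R -> R) :
  s @ F --> 0 -> (\forall l \near F, 0 < s l) ->
  continuous f -> (exists C : R, forall u, `|f u| <= C) ->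
  (\int[normal_prob m (s l)]_u (f u)%:E)%E @[l --> F] --> (f m)%:E.
Proof.
move=> s_cvg s_gt0 cf [C fC].
have mf : measurable_fun setT f := continuous_measurable_fun cf.
(* A bounded [f] has finite integrals, so the convergence can be checked among reals, by an epsilon
   argument. *)
have -> : (fun l => \int[normal_prob m (s l)]_u (f u)%:E)%E =
          (fun l => (\int[normal_prob m (s l)]_u f u)%:E).
  apply/funext => l; rewrite /Rintegral fineK//.
  apply: integrable_fin_num => //.
  exact: (bounded_integrable _ _ _ (normal_prob m (s l)) f C).
apply: cvg_EFin; first exact: nearW.
apply/cvgrPdist_le => e e0.
have e20 : 0 < e / 2 by rewrite divr_gt0.
have [t /= t0 ft] :
    exists2 t, 0 < t & forall u, `|u - m| < t -> `|f u - f m| <= e / 2.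
  have /cvgrPdist_le /(_ _ e20) /nbhs_ballP[t /= t0 tP] := cf m.
  exists t => // u; rewrite distrC => um; rewrite distrC; exact: tP.
have C0 : 0 <= C := le_trans (normr_ge0 _) (fC m).
(* Chosen so that [k * s l ^+ 2] is [2 * C] times the bound on the mass at distance at least [t]
   from [m]. It does not depend on [l]. *)
pose k := 2 * C * (Num.sqrt 2 * (4 / t ^+ 2)).
have k_cvg : k * s l ^+ 2 @[l --> F] --> 0.
  rewrite [X in _ --> X](_ : 0 = k * 0 ^+ 2); last by rewrite expr0n mulr0.
  apply: cvgMl_tmp.
  exact: (cvg_comp _ _ s_cvg (@exprn_continuous R 2 0)).
have /cvgrPdist_le /(_ _ e20) ke := k_cvg.
near=> l.
have sl0 : 0 < s l by near: l.
have kle : k * s l ^+ 2 <= e / 2.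
  (* Brings the goal to the form [|0 - k * s l ^+ 2| <= e / 2] in which [ke] is stated. *)
  rewrite (le_trans (ler_norm _))// -[X in X <= _]normrN -sub0r.
  by near: l.
rewrite /= distrC.
apply: le_trans (normr_RintegralB_le _ _ _ (normal_prob m (s l)) f
  [set u | t <= `|u - m|] (f m) (e / 2) C mf fC (fC m) (ltW e20)
  (measurable_tail _ _ _) _) _.
- by move=> u /negP; rewrite -ltNge; exact: ft.
- rewrite [leRHS]splitr lerD2l (le_trans _ kle)//.
  rewrite (_ : k * _ = 2 * C * (Num.sqrt 2 * (4 * s l ^+ 2 / t ^+ 2))); last first.
    by rewrite /k; ring.
  rewrite ler_wpM2l ?mulr_ge0// -lee_fin fineK; last first.
    by rewrite fin_num_measure//; exact: measurable_tail.
  exact: normal_prob_tail.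
Unshelve. all: by end_near. Qed.

(** Put [r = Num.sqrt x]. For [0 < x < 1], [|x * ln x| = 2 * r ^+ 2 * ln r^-1], and [ln y < y] at
    [y = r^-1] bounds this by [2 * r], which tends to 0. *)
Lemma cvg_xlnx_0 (R : realType) : x * ln x @[x --> (0 : R)^'+] --> 0.
Proof.
have b (x : R) : 0 < x < 1 -> `|x * ln x| <= 2 * Num.sqrt x.
  move=> /andP[x0 x1]; have s0 : 0 < Num.sqrt x by rewrite sqrtr_gt0.
  have xE : x = Num.sqrt x ^+ 2 by rewrite sqr_sqrtr// ltW.
  rewrite normrM gtr0_norm// ltr0_norm ?ln_lt0 ?x0// -lnV ?posrE//.
  rewrite [X in ln X^-1]xE -exprVn lnXn ?invr_gt0//.
  rewrite [X in X * _]xE -(mulr_natl (ln _)) mulrCA ler_wpM2l// expr2 -mulrA.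
  rewrite -[leRHS]mulr1 ler_wpM2l ?ltW//.
  by rewrite mulrC -ltr_pdivlMr// mul1r ln_sublinear// invr_gt0.
have sqrt0 : 2 * Num.sqrt x @[x --> (0 : R)^'+] --> 0.
  rewrite [X in _ --> X](_ : 0 = 2 * Num.sqrt 0); last by rewrite sqrtr0 mulr0.
  by apply: cvgMl_tmp; apply: cvg_at_right_filter; exact: sqrt_continuous.
apply: norm_cvg0; apply: (squeeze_cvgr _ _ sqrt0); last exact: cvg_cst.
near=> x; rewrite normr_ge0/=; apply: b; apply/andP; split; near: x.
  exact: nbhs_right_gt.
exact: nbhs_right_lt.
Unshelve. all: by end_near. Qed.

Theorem proposition4 (R : realType) (PP : set (probability (Omega R) R))
    (slo shi : R) (c : lq_data R) (alpha0 alpha1 alpha2 : R)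
    (hslo : 0 < slo) (hshi : slo <= shi) (hG : G_expectation PP slo shi)
    (hM : 0 <= lqM c) (hK : 0 < lqK c) (hrho : 0 < lq_rho c)
    (halpha2 : alpha2 < 0)
    (ha : forall lam : R, 0 < lam ->
       exploratory_solution PP c shi alpha0 alpha1 alpha2 lam)
    (hb : nonexploratory_solution PP c shi alpha0 alpha1 alpha2) :
  (forall x : R,
     weak_cvg (0 : R)^'+
       (fun lam => density_measure (thetastar c shi alpha1 alpha2 lam x))
       (dirac (ustar c shi alpha1 alpha2 x))) /\
  (forall x : R,
     (`|value PP c lam x - value_ne PP c x|)%E @[lam --> (0 : R)^'+] --> 0%E).
Proof.
(* As [alpha2 < 0], the curvature is [lqK c] plus a nonnegative term. This makes the variance
   [lam / curvature c shi alpha2] positive for [lam > 0]. *)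
have k0 : 0 < curvature c shi alpha2.
  rewrite /curvature subr_gt0 (le_lt_trans _ hK)// -mulrA -exprMn.
  by rewrite mulr_le0_ge0 ?sqr_ge0 ?(ltW halpha2).
have d0 : lam / curvature c shi alpha2 @[lam --> (0 : R)^'+] --> 0.
  rewrite -[X in _ --> X](mul0r (curvature c shi alpha2)^-1).
  by apply: cvgMr_tmp; apply: cvg_at_right_filter; exact: cvg_id.
split=> x.
  move=> f cf bf; rewrite integral_dirac//; last first.
    by apply/measurable_EFinP; exact: continuous_measurable_fun.
  rewrite diracT mul1e.
  (* The [density_measure] of a normal density is [normal_prob] by unfolding. *)
  apply: (normal_prob_weak_cvg _ _ _ _ _
    (fun lam => Num.sqrt (lam / curvature c shi alpha2))) => //.
    rewrite -[X in _ --> X](sqrtr0 R).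
    exact: (cvg_comp _ _ d0 (@sqrt_continuous R 0)).
  by near=> lam; rewrite sqrtr_gt0 divr_gt0.
rewrite -abse0; apply: cvg_abse; rewrite hb.1.
(* The argument of the logarithm in the exploratory value is [b * lam]. Splitting [ln (b * lam)]
   turns the difference of the values into [h lam], whose only singular term is [lam * ln lam]. *)
pose b := 2 * pi * expR 1 / curvature c shi alpha2.
have b0 : 0 < b by rewrite divr_gt0// !mulr_gt0 ?pi_gt0 ?expR_gt0.
pose h lam := (2 * lq_rho c)^-1 * (lam * (ln b - 1) + lam * ln lam).
apply: (@cvg_trans _ ((h lam)%:E @[lam --> (0 : R)^'+])); last first.
  apply: cvg_EFin; first exact: nearW.
  rewrite -[X in _ --> X](mulr0 (2 * lq_rho c)^-1); apply: cvgMl_tmp.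
  rewrite -[X in _ --> X](addr0 0); apply: cvgD; last exact: cvg_xlnx_0.
  rewrite -[X in _ --> X](mul0r (ln b - 1)); apply: cvgMr_tmp.
  by apply: cvg_at_right_filter; exact: cvg_id.
(* The formula for the exploratory value is given only for [lam > 0], so the two functions are
   compared near 0 on the right. *)
apply: near_eq_cvg; near=> lam.
have lam0 : 0 < lam by [].
rewrite (ha _ lam0).1 -EFinB; congr EFin.
rewrite (_ : 2 * pi * _ * lam / _ = b * lam); last by rewrite /b mulrAC.
by rewrite /h lnM ?posrE//; field; rewrite gt_eqF.
Unshelve. all: by end_near. Qed.
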